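(* Let $0\le l<n$. Define $f$ on the cover relations of $R_{n,l}$ as follows. Let $x=(A_1,\dots,A_{l+1})\in R_{n,l}$ and $a\in[n]\setminus(A_1\cup\cdots\cup A_{l+1})$, and consider the elements $y\gtrdot x$ obtained from $x$ by adding $a$ to some block (there are one or two of them). If there is exactly one such $y$, set $f(x\lessdot y):=1$. Otherwise $\max(A_i)<a<\min(A_{i+1})$ for some $1\le i\le l$; letting $y_1$ (resp. $y_2$) be obtained by adding $a$ to $A_i$ (resp. $A_{i+1}$), set $$f(x\lessdot y_1):=\frac{|A_1\cup\cdots\cup A_i|}{|A_1\cup\cdots\cup A_{l+1}|},\qquad f(x\lessdot y_2):=\frac{|A_{i+1}\cup\cdots\cup A_{l+1}|}{|A_1\cup\cdots\cup A_{l+1}|}.$$ Then $f$ is a normalized flow on $R_{n,l}$.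
   Context: $R_{n,l}$ is the poset whose elements are $(l+1)$-tuples $(A_1,\dots,A_{l+1})$ of nonempty subsets of $[n]=\{1,\dots,n\}$ with $\max(A_i)<\min(A_{i+1})$ for all $i\in[l]$, ordered by componentwise containment; ranks are labeled $1$ to $d=n-l$, the rank of $(A_1,\dots,A_{l+1})$ being $|A_1\cup\cdots\cup A_{l+1}|-l$. The covers of $x$ are exactly the tuples obtained by adding one element $a$ (not in any block) to one block while preserving the condition $\max(A_i)<\min(A_{i+1})$. A normalized flow on a finite graded poset $P$ with ranks $1,\dots,d$ is a function $f$ from cover relations to $\mathbb{R}_{\ge0}$ such that for each $1\le r\le d-1$: (NF1) $\sum_{y:\,x\lessdot y}f(x\lessdot y)$ is the same positive number for all $x$ of rank $r$; and (NF2) $\sum_{x:\,x\lessdot y}f(x\lessdot y)$ is the same positive number for all $y$ of rank $r+1$. *)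

(* Defs.v *)
From HB Require Import structures.
From mathcomp Require Import all_boot all_order all_algebra.

Set Implicit Arguments.
Unset Strict Implicit.
Unset Printing Implicit Defensive.

Import Order.TTheory GRing.Theory Num.Theory.

Local Open Scope ring_scope.

Section NormalizedFlow.
Context {disp : Order.disp_t} {P : finPOrderType disp}.

Definition covers (x y : P) : bool :=
  (x < y)%O && [forall z : P, ~~ ((x < z)%O && (z < y)%O)].

Definition graded (rk : P -> nat) (d : nat) : Prop :=
  [/\ forall x : P, (1 <= rk x <= d)%N,
      forall x : P, (forall y : P, ~~ (y < x)%O) -> rk x = 1%N,
      forall x : P, (forall y : P, ~~ (x < y)%O) -> rk x = d
    & forall x y : P, covers x y -> rk y = (rk x).+1].

(* Only the values of f on pairs x y with covers x y are relevant. *)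
Definition normalized_flow (rk : P -> nat) (d : nat) (R : realFieldType)
    (f : P -> P -> R) : Prop :=
  [/\ graded rk d,
      forall x y : P, covers x y -> 0 <= f x y
    & forall r : nat, (1 <= r <= d - 1)%N ->
        (exists2 c : R, 0 < c &
           forall x : P, rk x = r -> \sum_(y | covers x y) f x y = c)
        /\
        (exists2 c : R, 0 < c &
           forall y : P, rk y = r.+1 -> \sum_(x | covers x y) f x y = c)].

End NormalizedFlow.

(* The ground set [n] is 'I_n and blocks are indexed by 'I_l.+1, both counted
   from 0. A gap i : 'I_l sits between the consecutive blocks lo i and hi i. *)
Definition lo (l : nat) (i : 'I_l) : 'I_l.+1 := widen_ord (leqnSn l) i.
Definition hi (l : nat) (i : 'I_l) : 'I_l.+1 := lift ord0 i.

(* On nonempty sets these are the maximum and the minimum; the values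
   0 and n on set0 are junk. *)
Definition blockmax (n : nat) (A : {set 'I_n}) : nat :=
  (\max_(a in A) (a : nat))%N.
Definition blockmin (n : nat) (A : {set 'I_n}) : nat :=
  \big[minn/n]_(a in A) (a : nat).

Definition separated (n l : nat) (A : {ffun 'I_l.+1 -> {set 'I_n}}) : bool :=
  [forall i : 'I_l.+1, A i != set0] &&
  [forall i : 'I_l, (blockmax (A (lo i)) < blockmin (A (hi i)))%N].

Record Rposet (n l : nat) : Type := MkRposet {
  blocks :> {ffun 'I_l.+1 -> {set 'I_n}};
  _ : separated blocks }.

HB.instance Definition _ (n l : nat) := [isSub for @blocks n l].
HB.instance Definition _ (n l : nat) := [Finite of Rposet n l by <:].

Definition Rle (n l : nat) (x y : Rposet n l) : bool :=
  [forall i : 'I_l.+1, x i \subset y i].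

Fact Rle_refl (n l : nat) : reflexive (@Rle n l).
Proof. by move=> x; apply/forallP. Qed.

Fact Rle_anti (n l : nat) : antisymmetric (@Rle n l).
Proof.
move=> x y /andP[/forallP xy /forallP yx]; apply/val_inj/ffunP => i.
by apply/eqP; rewrite eqEsubset xy yx.
Qed.

Fact Rle_trans (n l : nat) : transitive (@Rle n l).
Proof.
move=> y x z /forallP xy /forallP yz; apply/forallP => i.
exact: subset_trans (xy i) (yz i).
Qed.

Fact Rposet_display : Order.disp_t. Proof. exact: (Order.Disp tt tt). Qed.

HB.instance Definition _ (n l : nat) :=
  Order.Le_isPOrder.Build Rposet_display (Rposet n l)
    (@Rle_refl n l) (@Rle_anti n l) (@Rle_trans n l).

Section Rflow.
Context {n l : nat}.
Implicit Types (x y : Rposet n l) (a : 'I_n) (i : 'I_l.+1).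

Definition supp x : {set 'I_n} := \bigcup_(i : 'I_l.+1) x i.

Definition Rrank x : nat := (#|supp x| - l)%N.

Definition add_to x a i : {ffun 'I_l.+1 -> {set 'I_n}} :=
  [ffun j => if j == i then a |: x j else x j].

Definition extensions x a : {set Rposet n l} :=
  [set y : Rposet n l | [exists i, blocks y == add_to x a i]].

(* The element a added in passing from x to a cover y, and the gap of x
   containing a, are unique when they exist; the values 0 in the remaining
   cases are junk. *)
Definition Rflow (R : realFieldType) x y : R :=
  if [pick a | (a \notin supp x) && (y \in extensions x a)] is Some a then
    if #|extensions x a| == 1%N then 1
    else if [pick i : 'I_l |
               (blockmax (x (lo i)) < a < blockmin (x (hi i)))%N] is Some i then
      if blocks y == add_to x a (lo i)
      then #|\bigcup_(j : 'I_l.+1 | (j <= lo i)%N) x j|%:R / #|supp x|%:R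
      else #|\bigcup_(j : 'I_l.+1 | (hi i <= j)%N) x j|%:R / #|supp x|%:R
    else 0
  else 0.

End Rflow.

(* Main.v *)
(* Adding a to the block A_i of x is legal iff all earlier blocks lie below a
   and all later ones above a; the covers of x are the legal additions. Writing
   L and R for the numbers of elements of the support of x below and above a,
   and m = L + R for its size, the flow has a uniform description: adding a
   above A_i gets L/m, below A_i gets R/m, inside A_i gets 1. At the two ends
   of the support this still gives m/m = 1.
   (NF1) For fixed a, at most one legal addition is above its block (exactly
   one iff L > 0) and at most one is below (iff R > 0), so the flow through a
   is 1 and the total flow out of x is n - m.
   (NF2) Let y have m + 1 elements and let B be a block of y with at least 2
   elements. Removing the maximum M or the minimum u of B gets L(M)/m or
   R(u)/m, and L(M) + R(u) = (m + 1) + (|B| - 2) by inclusion-exclusion; every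
   other removal gets 1. So B receives (|B| - 1)(m + 1)/m, which is also
   correct when |B| = 1, and y receives (m - l)(m + 1)/m in total. *)

Require Import Defs.
From HB Require Import structures.
From mathcomp Require Import all_boot all_order all_algebra.
From mathcomp Require Import zify ring.

Set Implicit Arguments.
Unset Strict Implicit.
Unset Printing Implicit Defensive.

Import Order.TTheory GRing.Theory Num.Theory.

Local Open Scope ring_scope.

Section Blocks.
Context {n l : nat}.
Implicit Types (A : {ffun 'I_l.+1 -> {set 'I_n}}) (B : {set 'I_n}).
Implicit Types (a b c : 'I_n) (i j : 'I_l.+1) (x y z : Rposet n l).

(** * Separation as an order relation between the elements of blocks *)

Lemma blockmax_ltP B (k : nat) : B != set0 ->
  reflect (forall b, b \in B -> (b < k)%N) (blockmax B < k)%N.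
Proof.
(* For [k = 0] both sides fail, the right one because [B] has an element. *)
move=> B0; case: k => [|k]; last first.
  rewrite ltnS.
  by refine (@bigmax_leqP _ (fun b => b \in B) k (fun b => b : nat)).
by rewrite ltn0; constructor=> lt0; case/set0Pn: B0 => b /lt0.
Qed.

(** The bound [k < n] takes care of the default value [n] of the minimum, so the empty set is
    covered as well. *)
Lemma blockmin_gtP B (k : nat) : (k < n)%N ->
  reflect (forall b, b \in B -> (k < b)%N) (k < blockmin B)%N.
Proof.
move=> kn; have ltE (r : seq 'I_n) :
  (k < \big[minn/n]_(b <- r | b \in B) (b : nat))%N
    = all (fun b => (b \in B) ==> (k < b)%N) r.
  elim: r => [|b r IHr]; first by rewrite big_nil.
  by rewrite big_cons /=; case: (b \in B); rewrite ?leq_min IHr.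
rewrite /blockmin ltE; apply: (iffP allP) => [H b|H b _]; last exact/implyP/H.
by apply/implyP/H; rewrite mem_index_enum.
Qed.

(** Adjacent comparisons chain by induction on the distance between blocks, passing through an
    element of each intermediate block; nonemptiness supplies it. *)
Lemma separatedP A :
  reflect ((forall i, A i != set0) /\
           (forall i j a b, (i < j)%N -> a \in A i -> b \in A j -> (a < b)%N))
          (separated A).
Proof.
apply: (iffP andP) => [[/forallP A0 /forallP Aadj]|[A0 Alt]]; last first.
  split; apply/forallP => // k; apply/blockmax_ltP => // a aA.
  apply/blockmin_gtP => // b bA; apply: (Alt _ _ _ _ _ aA bA).
  by rewrite /= /bump leq0n.
have adj (k : 'I_l) a b : a \in A (lo k) -> b \in A (hi k) -> (a < b)%N.
  move=> aA bA; have /blockmax_ltP-/(_ (A0 _) _ aA) lta := Aadj k.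
  have an : (a < n)%N by [].
  by move/(blockmin_gtP _ an): lta => /(_ _ bA).
split=> // i j a b ltij.
have [d jE] : exists d, (j : nat) = (i + d.+1)%N by exists (j - i).-1; lia.
elim: d j b jE {ltij} => [|d IHd] j b jE aA bA.
  have il : (i < l)%N by have := ltn_ord j; lia.
  apply: (adj (Ordinal il)); first by rewrite (_ : lo _ = i) //; apply: val_inj.
  by rewrite (_ : hi _ = j) //; apply: val_inj; rewrite /= /bump; lia.
have kl : (i + d.+1 < l)%N by have := ltn_ord j; lia.
have /set0Pn[c cA] := A0 (lo (Ordinal kl)).
apply: ltn_trans (IHd _ _ _ aA cA) _ => //.
apply: adj cA _; rewrite (_ : hi _ = j) //.
by apply: val_inj; rewrite /= /bump; lia.
Qed.

Lemma block_neq0 x i : x i != set0.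
Proof. by case: x => A /= /separatedP[]. Qed.

Lemma block_lt x i j a b :
  (i < j)%N -> a \in x i -> b \in x j -> (a < b)%N.
Proof. by case: x => A /= /separatedP[_ Alt]; apply: Alt. Qed.

Lemma block_inj x i j a : a \in x i -> a \in x j -> i = j.
Proof.
move=> ai aj; apply: val_inj; case: (ltngtP (i : nat) j) => // lt.
  by have := block_lt lt ai aj; rewrite ltnn.
by have := block_lt lt aj ai; rewrite ltnn.
Qed.

Lemma suppP x a : reflect (exists i, a \in x i) (a \in supp x).
Proof.
apply: (iffP bigcupP) => [[i _ ai]|[i ai]]; first by exists i.
by exists i.
Qed.

Lemma card_supp x : #|supp x| = (\sum_i #|x i|)%N.
Proof.
rewrite -sum1_card partition_disjoint_bigcup => [|i j ij].
  by apply: eq_bigr => i _; rewrite sum1_card.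
rewrite -setI_eq0; apply/eqP/setP => a; rewrite !inE.
by apply/negP => /andP[ai aj]; rewrite (block_inj ai aj) eqxx in ij.
Qed.

(** * Covers as additions of a single element *)

Lemma leR x y : (x <= y)%O = [forall i, x i \subset y i].
Proof. by []. Qed.

Lemma card_supp_lt x y : (x < y)%O -> (#|supp x| < #|supp y|)%N.
Proof.
rewrite lt_neqAle => /andP[neq]; rewrite leR => /forallP xy.
rewrite !card_supp ltn_neqAle.
rewrite leq_sum => [|i _]; last exact: subset_leq_card.
rewrite andbT; apply: contra neq => /eqP eq.
apply/eqP/val_inj/ffunP => i; apply/eqP.
rewrite eqEcard xy /= leqNgt; apply/negP => lt.
suff : (\sum_i #|x i| < \sum_i #|y i|)%N by rewrite eq ltnn.
rewrite (bigD1 i) //= [X in (_ < X)%N](bigD1 i) //= -addSn leq_add //.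
by apply: leq_sum => j _; apply: subset_leq_card.
Qed.

(** Recording the element and the block lets sums over covers become sums over pairs [(a, i)]. *)
Definition step x y a i := (a \notin supp x) && (blocks y == add_to x a i).

Lemma add_toE x a i j : add_to x a i j = if j == i then a |: x j else x j.
Proof. by rewrite ffunE. Qed.

Lemma step_blockE x y a i j :
  step x y a i -> y j = if j == i then a |: x j else x j.
Proof. by case/andP=> _ /eqP ->; rewrite add_toE. Qed.

Lemma step_mem x y a i : step x y a i -> a \in y i.
Proof. by move/step_blockE->; rewrite eqxx setU11. Qed.

Lemma step_supp x y a i : step x y a i -> supp y = a |: supp x.
Proof.
move=> st; apply/setP => b; rewrite in_setU1; apply/suppP/orP.
  case=> j; rewrite (step_blockE _ st); case: eqP => [_|_ bj].
    rewrite in_setU1 => /orP[|bj]; first by left.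
    by right; apply/suppP; exists j.
  by right; apply/suppP; exists j.
case=> [/eqP->|/suppP[j bj]]; first by exists i; apply: step_mem st.
by exists j; rewrite (step_blockE _ st); case: eqP => // _; rewrite setU1r.
Qed.

Lemma step_card x y a i : step x y a i -> #|supp y| = #|supp x|.+1.
Proof. by move=> st; rewrite (step_supp st) cardsU1; case/andP: st => ->. Qed.

Lemma step_lt x y a i : step x y a i -> (x < y)%O.
Proof.
move=> st; rewrite lt_neqAle; apply/andP; split.
  by apply/eqP => xy; have := step_card st; rewrite xy; lia.
rewrite leR; apply/forallP => j; rewrite (step_blockE _ st).
by case: eqP => // _; apply: subsetU1.
Qed.

Lemma step_inj x y a i b j : step x y a i -> step x y b j -> (a, i) = (b, j).
Proof.
move=> sta stb; have eab : a = b.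
  have : a \in supp y by rewrite (step_supp sta) setU11.
  rewrite (step_supp stb) in_setU1 => /orP[/eqP//|].
  by case/andP: sta => /negPf->.
rewrite -eab in stb *.
by rewrite (block_inj (step_mem sta) (step_mem stb)).
Qed.

(** Any element of a block of [y] missing from that block of [x] can be added: the enlarged tuple
    lies inside [y] and inherits its ordering. *)
Lemma lt_step x y : (x < y)%O ->
  exists z a i, [/\ step x z a i & (z <= y)%O].
Proof.
rewrite lt_neqAle leR => /andP[neq /forallP xy].
have [i nyx] : exists i, ~~ (y i \subset x i).
  apply/existsP; rewrite -negb_forall; apply: contra neq => /forallP yx.
  by apply/eqP/val_inj/ffunP => i; apply/eqP; rewrite eqEsubset xy yx.
have /subsetPn[a ay nax] := nyx.
have sub j : add_to x a i j \subset y j.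
  rewrite add_toE; case: eqP => [->|_] //.
  by rewrite subUset sub1set ay xy.
have sep : separated (add_to x a i).
  apply/separatedP; split=> [j|j k b c jk bj ck].
    have /set0Pn[b bj] := block_neq0 x j; apply/set0Pn; exists b.
    by rewrite add_toE; case: eqP => // _; rewrite setU1r.
  exact: block_lt jk (subsetP (sub _) _ bj) (subsetP (sub _) _ ck).
exists (MkRposet sep), a, i; split; last by rewrite leR; apply/forallP.
rewrite /step eqxx andbT; apply/suppP => -[j aj].
have eij : i = j by apply: block_inj ay (subsetP (xy _) _ aj).
by rewrite eij aj in nax.
Qed.

Lemma coversP x y : reflect (exists a i, step x y a i) (covers x y).
Proof.
apply: (iffP andP) => [[xy /forallP nz]|[a [i st]]].
  have [z [a [i [st zy]]]] := lt_step xy.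
  have := nz z; rewrite (step_lt st) /= lt_neqAle zy andbT negbK => /eqP <-.
  by exists a, i.
split; first exact: step_lt st.
(* Supports grow strictly along [<], and a step adds one element, so nothing fits between. *)
apply/forallP => z; apply/negP => /andP[/card_supp_lt xz /card_supp_lt zy].
by have := step_card st; lia.
Qed.

Lemma card_supp_ge x : (l < #|supp x|)%N.
Proof.
have -> : (l < #|supp x|)%N = (#|'I_l.+1| <= #|supp x|)%N by rewrite card_ord.
rewrite card_supp -sum1_card.
by apply: leq_sum => i _; rewrite card_gt0 block_neq0.
Qed.

(** * Legal blocks for a fixed new element *)

Lemma add_to_separatedP x a i : a \notin supp x ->
  reflect ((forall j b, (j < i)%N -> b \in x j -> (b < a)%N) /\
           (forall j b, (i < j)%N -> b \in x j -> (a < b)%N))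
          (separated (add_to x a i)).
Proof.
move=> ax; apply: (iffP (separatedP _)) => [[_ lt]|[ltl ltr]].
  split=> j b ij bj.
    apply: (lt _ _ _ _ ij); rewrite add_toE ?eqxx ?setU11 //.
    by case: eqP => // _; rewrite setU1r.
  apply: (lt _ _ _ _ ij); rewrite add_toE ?eqxx ?setU11 //.
  by case: eqP => // _; rewrite setU1r.
split=> [j|j k b c jk].
  have /set0Pn[b bj] := block_neq0 x j; apply/set0Pn; exists b.
  by rewrite add_toE; case: eqP => // _; rewrite setU1r.
rewrite !add_toE; case: eqP => [eji|_]; case: eqP => [eki|_].
- by move: jk; rewrite eji eki ltnn.
- rewrite in_setU1 => /orP[/eqP->|bj] ck; last exact: block_lt jk bj ck.
  by apply: ltr ck; rewrite -eji.
- move=> bj; rewrite in_setU1 => /orP[/eqP->|ck]; last exact: block_lt jk bj ck.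
  by apply: ltl bj; rewrite -eki.
exact: block_lt jk.
Qed.

Definition below x a i := [forall b in x i, (b < a)%N].
Definition above x a i := [forall b in x i, (a < b)%N].
Definition lcount x a := #|[set b in supp x | (b < a)%N]|.
Definition rcount x a := #|[set b in supp x | (a < b)%N]|.

Lemma belowP x a i : reflect (forall b, b \in x i -> (b < a)%N) (below x a i).
Proof. exact: forall_inP. Qed.

Lemma aboveP x a i : reflect (forall b, b \in x i -> (a < b)%N) (above x a i).
Proof. exact: forall_inP. Qed.

Lemma below_aboveF x a i : below x a i -> above x a i = false.
Proof.
move/belowP=> lt; apply/aboveP => gt.
have /set0Pn[b bi] := block_neq0 x i.
by have := lt b bi; have := gt b bi; lia.
Qed.

Lemma lcountDrcount x a : a \notin supp x ->
  (lcount x a + rcount x a)%N = #|supp x|.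
Proof.
move=> ax; rewrite /lcount /rcount -cardsUI [X in (_ + X)%N](_ : _ = 0%N).
  rewrite addn0; congr #|pred_of_set _|; apply/setP => b; rewrite !inE.
  case bx: (b \in supp x) => //=; rewrite -neq_ltn.
  by apply: contraNneq ax => /ord_inj <-.
by apply/eqP; rewrite cards_eq0; apply/eqP/setP => b; rewrite !inE; lia.
Qed.

(** Legality at the later block puts the earlier one below [a], and conversely. The uniqueness
    lemmas that follow all rest on this. *)
Lemma sep_lt x a i j : a \notin supp x ->
  separated (add_to x a i) -> separated (add_to x a j) -> (i < j)%N ->
  below x a i /\ above x a j.
Proof.
move=> ax /(add_to_separatedP _ ax)[_ Hi] /(add_to_separatedP _ ax)[Hj _] ij.
by split; [apply/belowP => b; apply: Hj | apply/aboveP => b; apply: Hi].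
Qed.

Lemma below_unique x a i j : a \notin supp x ->
  separated (add_to x a i) -> below x a i ->
  separated (add_to x a j) -> below x a j -> i = j.
Proof.
move=> ax si bi sj bj; apply: val_inj; case: (ltngtP (i : nat) j) => // ij.
  by have [_] := sep_lt ax si sj ij; rewrite below_aboveF.
by have [_] := sep_lt ax sj si ij; rewrite below_aboveF.
Qed.

Lemma above_unique x a i j : a \notin supp x ->
  separated (add_to x a i) -> above x a i ->
  separated (add_to x a j) -> above x a j -> i = j.
Proof.
move=> ax si ai sj aj; apply: val_inj; case: (ltngtP (i : nat) j) => // ij.
  by have [/below_aboveF] := sep_lt ax si sj ij; rewrite ai.
by have [/below_aboveF] := sep_lt ax sj si ij; rewrite aj.
Qed.

(** Block [i] has elements on both sides of [a]; earlier blocks lie below the smaller one, later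
    blocks above the larger one. *)
Lemma interior_sep x a i : a \notin supp x ->
  ~~ below x a i -> ~~ above x a i -> separated (add_to x a i).
Proof.
move=> ax /forall_inPn[b bi nba] /forall_inPn[c ci nac].
have ltab : (a <= b)%N by rewrite leqNgt.
have ltca : (c <= a)%N by rewrite leqNgt.
apply/(add_to_separatedP _ ax); split=> j d ij dj.
  by have := block_lt ij dj ci; lia.
by have := block_lt ij bi dj; lia.
Qed.

Lemma interior_unique x a i j : a \notin supp x ->
  separated (add_to x a i) -> ~~ below x a i -> ~~ above x a i ->
  separated (add_to x a j) -> i = j.
Proof.
move=> ax si nbi nai sj; apply: val_inj; case: (ltngtP (i : nat) j) => // ij.
  by have [bi] := sep_lt ax si sj ij; rewrite bi in nbi.
by have [_ ai] := sep_lt ax sj si ij; rewrite ai in nai.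
Qed.

(** Legality at [i] pushes every other block to one side of [a], so only block [i] could surround
    [a]. *)
Lemma sep_below_above x a i : a \notin supp x ->
  separated (add_to x a i) -> below x a i || above x a i ->
  forall j, below x a j || above x a j.
Proof.
move=> ax /(add_to_separatedP _ ax)[ltl ltr] iP j.
case: (ltngtP (i : nat) j) => [ij|ij|/val_inj <- //].
  by apply/orP; right; apply/aboveP => b; apply: ltr.
by apply/orP; left; apply/belowP => b; apply: ltl.
Qed.

(** The last block below [a] is legal: earlier blocks lie below it, and later ones, not being below
    [a], are above. *)
Lemma exists_below x a : a \notin supp x ->
  (forall i, below x a i || above x a i) -> (0 < lcount x a)%N ->
  exists i, separated (add_to x a i) && below x a i.
Proof.
move=> ax noint; rewrite /lcount card_gt0 => /set0Pn[b].
rewrite inE => /andP[/suppP[i0 bi0] ba].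
have bel0 : below x a i0.
  have := noint i0; case: (below x a i0) => //= /aboveP/(_ _ bi0); lia.
case: (arg_maxnP (fun i => i : nat) bel0) => i bi maxi.
exists i; rewrite bi andbT; apply/(add_to_separatedP _ ax); split=> j c ij cj.
  have /set0Pn[d di] := block_neq0 x i.
  by have := block_lt ij cj di; have := belowP _ _ _ bi d di; lia.
have := noint j.
case: (boolP (below x a j)) => [/maxi /=|_ /= /aboveP]; last exact.
by rewrite leqNgt ij.
Qed.

(** Mirror image, with the first block above [a]. *)
Lemma exists_above x a : a \notin supp x ->
  (forall i, below x a i || above x a i) -> (0 < rcount x a)%N ->
  exists i, separated (add_to x a i) && above x a i.
Proof.
move=> ax noint; rewrite /rcount card_gt0 => /set0Pn[b].
rewrite inE => /andP[/suppP[i0 bi0] ba].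
have abo0 : above x a i0.
  have := noint i0; case: (boolP (below x a i0)) => //= /belowP/(_ _ bi0); lia.
case: (arg_minnP (fun i => i : nat) abo0) => i ai mini.
exists i; rewrite ai andbT.
apply/(add_to_separatedP _ ax); split=> j c ij cj; last first.
  have /set0Pn[d di] := block_neq0 x i.
  by have := block_lt ij di cj; have := aboveP _ _ _ ai d di; lia.
have := noint j.
case: (boolP (above x a j)) => [/mini /=|_ /=]; first by rewrite leqNgt ij.
by rewrite orbF => /belowP; apply.
Qed.

Lemma lcount_gt0 x a i : below x a i -> (0 < lcount x a)%N.
Proof.
move/belowP=> bi; have /set0Pn[b bx] := block_neq0 x i.
rewrite card_gt0; apply/set0Pn; exists b; rewrite inE bi // andbT.
by apply/suppP; exists i.
Qed.

Lemma rcount_gt0 x a i : above x a i -> (0 < rcount x a)%N.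
Proof.
move/aboveP=> ai; have /set0Pn[b bx] := block_neq0 x i.
rewrite card_gt0; apply/set0Pn; exists b; rewrite inE ai // andbT.
by apply/suppP; exists i.
Qed.

(** * The uniform weight and the flow through one element *)

Section Weight.
Context {R : realFieldType}.

Definition weight x a i : R :=
  if below x a i then (lcount x a)%:R / #|supp x|%:R
  else if above x a i then (rcount x a)%:R / #|supp x|%:R else 1.

Lemma weight_ge0 x a i : 0 <= weight x a i.
Proof. by rewrite /weight; do 2?case: ifP => _; rewrite ?divr_ge0 ?ler0n. Qed.

Lemma supp_neq0 x : #|supp x|%:R != 0 :> R.
Proof. by rewrite pnatr_eq0; have := card_supp_ge x; case: #|_|. Qed.

Lemma sum_weight x a : a \notin supp x ->
  \sum_(i | separated (add_to x a i)) weight x a i = 1.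
Proof.
(* If some block surrounds [a], it is the only legal one and has weight 1. *)
move=> ax; case: (boolP [forall i, below x a i || above x a i]); last first.
  rewrite negb_forall => /existsP[i]; rewrite negb_or => /andP[nbi nai].
  have si := interior_sep ax nbi nai.
  rewrite (big_pred1 i) => [|j /=].
    by rewrite /weight (negPf nbi) (negPf nai).
  by apply/idP/eqP => [/(interior_unique ax si nbi nai)|->].
(* Otherwise the legal blocks split into those below and those above [a]. Each group has one member,
   or none when the corresponding count is 0. *)
move/forallP=> noint; rewrite (bigID (below x a)) /=.
set m : R := #|supp x|%:R.
have -> : \sum_(i | separated (add_to x a i) && below x a i) weight x a i
    = (lcount x a)%:R / m.
  have [L0|Lp] := posnP (lcount x a).
    rewrite L0 mul0r big_pred0 // => i; apply/negP => /andP[_ /lcount_gt0].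
    by rewrite L0.
  have [i /andP[si bi]] := exists_below ax noint Lp.
  rewrite (big_pred1 i) => [|j /=]; first by rewrite /weight bi.
  by apply/andP/eqP => [[sj bj]|->//]; apply: below_unique bj si bi.
have -> : \sum_(i | separated (add_to x a i) && ~~ below x a i) weight x a i
    = (rcount x a)%:R / m.
  have [R0|Rp] := posnP (rcount x a).
    rewrite R0 mul0r big_pred0 // => i; apply/negP => /andP[_ nb].
    by have := noint i; rewrite (negPf nb) => /rcount_gt0; rewrite R0.
  have [i /andP[si ai]] := exists_above ax noint Rp.
  rewrite (big_pred1 i) => [|j /=].
    by rewrite /weight ai ifN //; apply/negP => /below_aboveF; rewrite ai.
  apply/andP/eqP => [[sj nbj]|->].
    have aj := noint j; rewrite (negPf nbj) /= in aj.
    exact: above_unique aj si ai.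
  by split=> //; apply/negP => /below_aboveF; rewrite ai.
by rewrite -mulrDl -natrD lcountDrcount // divff // supp_neq0.
Qed.

(** * Agreement of [Rflow] with the uniform weight *)

Lemma extensions_step x a y : a \notin supp x ->
  (y \in extensions x a) = [exists i, step x y a i].
Proof. by move=> ax; rewrite inE; apply: eq_existsb => i; rewrite /step ax. Qed.

Lemma step_sep x y a i : step x y a i -> separated (add_to x a i).
Proof. by case/andP=> _ /eqP <-; case: y. Qed.

Lemma sep_step x a i : a \notin supp x -> separated (add_to x a i) ->
  exists y, step x y a i.
Proof. by move=> ax s; exists (MkRposet s); rewrite /step ax /=. Qed.

(** An extension determines its block and a block its extension, so one is unique exactly when the
    other is. *)
Lemma card_extensions x y a i : step x y a i ->
  (#|extensions x a| == 1%N)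
    = [forall j, separated (add_to x a j) ==> (j == i)].
Proof.
move=> st; have [ax _] := andP st.
have yext : y \in extensions x a.
  by rewrite extensions_step //; apply/existsP; exists i.
apply/eqP/forallP => [c1 j|un].
  apply/implyP => /(sep_step ax)[z stz].
  have zext : z \in extensions x a.
    by rewrite extensions_step //; apply/existsP; exists j.
  have /eqP/cards1P[t et] := c1; rewrite et !inE in yext zext.
  rewrite (eqP zext) -(eqP yext) in stz.
  by case: (step_inj stz st) => ->.
apply/eqP/cards1P; exists y; apply/setP => z; rewrite in_set1.
rewrite extensions_step //; apply/existsP/eqP => [[j stz]|->]; last by exists i.
have := un j; rewrite (step_sep stz) /= => /eqP eji; apply: val_inj => /=.
by case/andP: stz => _ /eqP->; case/andP: st => _ /eqP->; rewrite eji.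
Qed.

(** This pins down the gap picked by [Rflow]. If one gap preceded another, the upper block of the
    first would be at or before the lower block of the second, hence both above and below [a]. *)
Lemma gap_inj x a (k k' : 'I_l) :
  (forall b, b \in x (lo k) -> (b < a)%N) ->
  (forall b, b \in x (hi k) -> (a < b)%N) ->
  (blockmax (x (lo k')) < a < blockmin (x (hi k')))%N -> k' = k.
Proof.
move=> lok hik /andP[/blockmax_ltP lok' /blockmin_gtP hik'].
have {}lok' := lok' (block_neq0 x (lo k')).
have {}hik' := hik' (ltn_ord a).
have lohi (i j : 'I_l) : (forall b, b \in x (hi i) -> (a < b)%N) ->
    (forall b, b \in x (lo j) -> (b < a)%N) -> ~~ (i < j)%N.
  move=> hii loj; apply/negP => ij.
  have /set0Pn[b bi] := block_neq0 x (hi i).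
  have /set0Pn[c cj] := block_neq0 x (lo j).
  have := hii b bi; have := loj c cj.
  have [eij|nij] := eqVneq (hi i) (lo j).
    by rewrite -eij in cj; have := loj b; rewrite -eij => /(_ bi); lia.
  suff /block_lt/(_ bi cj) : (hi i < lo j)%N by lia.
  by move: nij; rewrite -val_eqE /= /bump /= ltn_neqAle; lia.
apply: val_inj => /=; have := lohi _ _ hik lok'; have := lohi _ _ hik' lok.
by case: ltngtP.
Qed.

(** Identifies the unions in [Rflow] with the sets counted by [lcount] and [rcount]: no block
    straddles [a]. *)
Lemma gap_sets x a (k : 'I_l) :
  below x a (lo k) -> above x a (hi k) ->
  \bigcup_(j : 'I_l.+1 | (j <= lo k)%N) x j
    = [set b in supp x | (b < a)%N]
  /\ \bigcup_(j : 'I_l.+1 | (hi k <= j)%N) x j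
    = [set b in supp x | (a < b)%N].
Proof.
move=> /belowP bk /aboveP ak.
have lowP j b : (j <= lo k)%N -> b \in x j -> (b < a)%N.
  have /set0Pn[c cx] := block_neq0 x (lo k).
  rewrite leq_eqVlt => /orP[/eqP/val_inj->|jk bj]; first exact: bk.
  exact: ltn_trans (block_lt jk bj cx) (bk _ cx).
have highP j b : (hi k <= j)%N -> b \in x j -> (a < b)%N.
  have /set0Pn[c cx] := block_neq0 x (hi k).
  rewrite leq_eqVlt => /orP[/eqP/val_inj<-|jk bj]; first exact: ak.
  exact: ltn_trans (ak _ cx) (block_lt jk cx bj).
have hiE : (hi k : nat) = k.+1 by rewrite /= /bump.
split; apply/setP => b; rewrite inE; apply/bigcupP/andP.
- by move=> [j jk bj]; split; [apply/suppP; exists j | apply: lowP bj].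
- move=> [/suppP[j bj] ba]; exists j => //; rewrite leqNgt; apply/negP => kj.
  by have := highP j b; rewrite hiE => /(_ kj bj); lia.
- by move=> [j jk bj]; split; [apply/suppP; exists j | apply: highP bj].
move=> [/suppP[j bj] ba]; exists j => //; rewrite hiE ltnNge; apply/negP => jk.
by have := lowP j b jk bj; lia.
Qed.

Lemma Rflow_step x y a i : step x y a i -> Rflow R x y = weight x a i.
Proof.
move=> st; have /andP[ax yE] := st; have si := step_sep st.
have yext : y \in extensions x a.
  by rewrite extensions_step //; apply/existsP; exists i.
rewrite /Rflow.
case: pickP => [a' /andP[ax' ya']|/(_ a)]; last by rewrite ax yext.
have {a' ax' ya'} -> : a' = a.
  move: ya'; rewrite extensions_step // => /existsP[j sta'].
  by case: (step_inj sta' st).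
rewrite (card_extensions st).
(* With one legal block, the quotient must be 1: a nonzero count on the opposite side would produce
   a second legal block. *)
case: ifPn => [/forallP un|nun].
  have m0 := supp_neq0 x.
  rewrite /weight; case: ifPn => [bi|nbi]; last case: ifPn => // ai.
    have R0 : rcount x a = 0%N.
      apply/eqP; rewrite -leqn0 leqNgt; apply/negP => Rp.
      have noint := sep_below_above ax si (introT orP (or_introl bi)).
      have [j /andP[sj aj]] := exists_above ax noint Rp.
      by move: (un j) aj; rewrite sj => /eqP ->; rewrite below_aboveF.
    by rewrite -(lcountDrcount ax) R0 addn0 in m0 *; rewrite divff.
  have L0 : lcount x a = 0%N.
    apply/eqP; rewrite -leqn0 leqNgt; apply/negP => Lp.
    have noint := sep_below_above ax si (introT orP (or_intror ai)).
    have [j /andP[sj bj]] := exists_below ax noint Lp.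
    by move: (un j) bj; rewrite sj => /eqP ->; rewrite (negPf nbi).
  by rewrite -(lcountDrcount ax) L0 add0n in m0 *; rewrite divff.
move: nun; rewrite negb_forall => /existsP[j].
rewrite negb_imply => /andP[sj nji].
(* Two legal blocks are adjacent, since an element of a block strictly between them would be both
   above and below [a]. *)
have ends i1 i2 : separated (add_to x a i1) -> separated (add_to x a i2) ->
    (i1 < i2)%N -> exists2 k, i1 = lo k & i2 = hi k.
  move=> s1 s2 lt12; have il : (i1 < l)%N by have := ltn_ord i2; lia.
  exists (Ordinal il); apply: val_inj => //=; rewrite /bump /=.
  apply/eqP; rewrite eqn_leq lt12 andbT leqNgt; apply/negP => lt2.
  have ml : (i1.+1 < l.+1)%N by lia.
  have /set0Pn[b bm] := block_neq0 x (Ordinal ml).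
  have [_ /(_ (Ordinal ml) b (leqnn _) bm)] := add_to_separatedP _ ax s1.
  have [/(_ (Ordinal ml) b lt2 bm)] := add_to_separatedP _ ax s2.
  lia.
have lo_hi (k : 'I_l) : (lo k < hi k)%N by rewrite /= /bump.
have [k [ik sl sh]] : exists k, [/\ i = lo k \/ i = hi k,
    separated (add_to x a (lo k)) & separated (add_to x a (hi k))].
  case: (ltngtP (i : nat) j) => ij.
  - have [k ei ej] := ends _ _ si sj ij.
    by exists k; rewrite -ei -ej; split=> //; left.
  - have [k ej ei] := ends _ _ sj si ij.
    by exists k; rewrite -ei -ej; split=> //; right.
  by rewrite (val_inj ij) eqxx in nji.
have [bk ak] := sep_lt ax sl sh (lo_hi k).
case: pickP => [k'|/(_ k)]; last first.
  have -> : (blockmax (x (lo k)) < a)%N.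
    by apply/blockmax_ltP; [exact: block_neq0 | apply/belowP].
  have -> // : (a < blockmin (x (hi k)))%N.
  by apply/blockmin_gtP; [exact: ltn_ord | apply/aboveP].
move=> /(gap_inj (belowP _ _ _ bk) (aboveP _ _ _ ak)) ->.
have [-> ->] := gap_sets bk ak.
case: ik => ei; rewrite ei in st yE *.
  by rewrite yE /weight bk.
rewrite ifN.
  by rewrite /weight ak ifN //; apply/negP => /below_aboveF; rewrite ak.
(* Here [a] went to the upper block; the test for the lower block fails because a cover determines
   its block. *)
apply/negP => yE'; have st' : step x y a (lo k) by rewrite /step ax.
have /(congr1 (fun p => nat_of_ord p.2)) := step_inj st st'.
by rewrite /= /bump; lia.
Qed.

(** * Flow out of an element (NF1) *)

(** A cover comes from exactly one pair, so the sum has one term or none. This form permits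
    exchanging summations. *)
Lemma covers_Rflow x y :
  (if covers x y then Rflow R x y else 0)
    = \sum_(p : 'I_n * 'I_l.+1 | step x y p.1 p.2) weight x p.1 p.2.
Proof.
case: coversP => [[a [i st]]|nst].
  rewrite (big_pred1 (a, i)) => [|[b j] /=]; first exact: Rflow_step.
  by apply/idP/eqP => [st'|[-> ->]//]; apply: step_inj st' st.
by rewrite big_pred0 // => -[b j]; apply/negP => st; apply: nst; exists b, j.
Qed.

Lemma sum_covers_above x :
  \sum_(y | covers x y) Rflow R x y = (n - #|supp x|)%:R.
Proof.
rewrite big_mkcond; under eq_bigr do rewrite covers_Rflow.
rewrite (exchange_big_dep
  (fun p => (p.1 \notin supp x) && separated (add_to x p.1 p.2))) /=; last first.
  by move=> y p _ st; rewrite (step_sep st); case/andP: st => ->.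
(* A legal pair determines its cover, leaving one term in the inner sum. *)
under eq_bigr => p /andP[ax sp].
  have [y st] := sep_step ax sp.
  rewrite (big_pred1 y) => [|z /=]; first over.
  apply/idP/eqP => [st'|->//]; apply: val_inj => /=.
  by case/andP: st' => _ /eqP->; case/andP: st => _ /eqP->.
(* Grouped by [a], each element outside the support contributes 1. *)
rewrite -(pair_big_dep (fun a => a \notin supp x)
  (fun a i => separated (add_to x a i)) (weight x)) /=.
under eq_bigr => a ax do rewrite sum_weight //.
rewrite sumr_const; congr (_ *+ _).
have /(congr1 (subn^~ #|supp x|)) := cardC (mem (supp x)).
by rewrite addKn card_ord => <-; apply: eq_card.
Qed.

(** * Flow into an element (NF2) *)

(** Shrinking blocks preserves their ordering; the size bound keeps block [i] nonempty. *)
Lemma step_down y a i : a \in y i -> (1 < #|y i|)%N -> exists x, step x y a i.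
Proof.
move=> ai cardi; pose A := [ffun j => if j == i then y j :\ a else y j].
have sub j : A j \subset y j.
  by rewrite ffunE; case: ifP => _; rewrite ?subsetDl.
have sep : separated A.
  apply/separatedP.
  split=> [j|j k b c jk /(subsetP (sub j)) bj /(subsetP (sub k)) ck].
    rewrite ffunE; case: (j =P i) => [->|_]; last exact: block_neq0.
    by rewrite -card_gt0; move: cardi; rewrite (cardsD1 a) ai.
  exact: block_lt jk bj ck.
exists (MkRposet sep); apply/andP; split.
  apply/suppP => -[j aj]; have eji := block_inj (subsetP (sub _) _ aj) ai.
  by move: aj; rewrite eji ffunE eqxx !inE eqxx.
apply/eqP/ffunP => j; rewrite add_toE ffunE.
by case: eqP => // ->; rewrite setD1K.
Qed.

Lemma step_card_block x y a i : step x y a i -> (1 < #|y i|)%N.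
Proof.
move=> st; have /andP[ax _] := st; rewrite (step_blockE _ st) eqxx cardsU1.
rewrite (_ : a \notin x i); first by rewrite ltnS card_gt0 block_neq0.
by apply: contra ax => ai; apply/suppP; exists i.
Qed.

Lemma step_injl x x' y a i : step x y a i -> step x' y a i -> x = x'.
Proof.
have blockD z j : step z y a i -> z j = if j == i then y j :\ a else y j.
  move=> st; have /andP[az _] := st; rewrite (step_blockE _ st).
  case: eqP => // ->; rewrite setU1K //.
  by apply: contra az => ai; apply/suppP; exists i.
move=> st st'; apply/val_inj/ffunP => j /=.
by rewrite (blockD x) // (blockD x').
Qed.

(* The weight of a step of y down from block i at a, read off from y alone;
   .-1 is harmless since the support of y has at least 2 elements then. *)
Definition down_weight y a i : R :=
  if [forall b in y i :\ a, (b < a)%N] then (lcount y a)%:R / #|supp y|.-1%:R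
  else if [forall b in y i :\ a, (a < b)%N]
    then (rcount y a)%:R / #|supp y|.-1%:R else 1.

Lemma step_down_weight x y a i :
  step x y a i -> weight x a i = down_weight y a i.
Proof.
move=> st; have /andP[ax _] := st; rewrite /weight /down_weight /below /above.
have -> : y i :\ a = x i.
  rewrite (step_blockE _ st) eqxx setU1K //.
  by apply: contra ax => ai; apply/suppP; exists i.
rewrite (step_card st) /lcount /rcount (step_supp st).
(* Strict comparison with [a] excludes [a] itself, so the counts in [x] and [y] agree. *)
have E (P : pred 'I_n) : P a = false ->
    [set b in a |: supp x | P b] = [set b in supp x | P b].
  move=> Pa; apply/setP => b; rewrite !inE.
  by case: eqP => [->|//]; rewrite Pa !andbF.
by rewrite (E (fun b => (b < a)%N)) ?ltnn // (E (fun b => (a < b)%N)) ?ltnn.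
Qed.

Lemma sum_down_weight y i :
  \sum_(a in y i | (1 < #|y i|)%N) down_weight y a i
    = (#|y i|%:R - 1) * (#|supp y|%:R / #|supp y|.-1%:R).
Proof.
have y0 : (0 < #|y i|)%N by rewrite card_gt0 block_neq0.
(* A singleton block allows no removal, matching the factor 0 on the right. *)
case: (ltnP 1 #|y i|) => [c2|c1]; last first.
  rewrite big_pred0 => [|a]; last by rewrite andbF.
  by have -> : #|y i| = 1%N by [lia]; rewrite subrr mul0r.
under eq_bigl do rewrite andbT.
have /set0Pn[b0 b0y] := block_neq0 y i.
have [M My maxM] := arg_maxnP (fun b : 'I_n => b : nat) b0y.
have [m my minm] := arg_minnP (fun b : 'I_n => b : nat) b0y.
have {}My : M \in y i := My; have {}my : m \in y i := my.
have mneM : m != M.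
  apply: contraTneq c2 => mM; rewrite -leqNgt -(cards1 m) subset_leq_card //.
  apply/subsetP => b bi; rewrite in_set1 -val_eqE /=; apply/eqP.
  by have := maxM b bi; have := minm b bi; rewrite -mM /=; lia.
have ltmM : (m < M)%N.
  by rewrite ltn_neqAle mneM; apply: minm.
rewrite (bigD1 M) //= (bigD1 m) /=; last by rewrite my.
have -> : down_weight y M i = (lcount y M)%:R / #|supp y|.-1%:R.
  rewrite /down_weight ifT //.
  apply/forall_inP => b; rewrite !inE => /andP[bM bi].
  by rewrite ltn_neqAle bM; apply: maxM.
have -> : down_weight y m i = (rcount y m)%:R / #|supp y|.-1%:R.
  rewrite /down_weight ifF; last first.
    apply/forall_inP => /(_ M); rewrite !inE eq_sym mneM My => /(_ isT); lia.
  rewrite ifT //; apply/forall_inP => b; rewrite !inE => /andP[bm bi].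
  by rewrite ltn_neqAle eq_sym bm; apply: minm.
(* For any other element, [M] and [m] remain in the block on either side of it. *)
rewrite (eq_bigr (fun _ => 1)); last first.
  move=> b /andP[/andP[bi nbM] nbm]; rewrite /down_weight ifF; last first.
    apply/forall_inP => /(_ M); rewrite !inE eq_sym nbM My => /(_ isT).
    by have := maxM b bi => /=; lia.
  rewrite ifF //; apply/forall_inP => /(_ m).
  rewrite !inE eq_sym nbm my => /(_ isT).
  by have := minm b bi => /=; lia.
have card2 : #|y i :\ M :\ m| = (#|y i| - 2)%N.
  rewrite (cardsD1 M (y i)) (cardsD1 m (y i :\ M)).
  by rewrite My !inE mneM my add1n subn2.
rewrite (eq_bigl (fun b => b \in y i :\ M :\ m)) => [|b]; last first.
  by rewrite !inE andbC [(b \in y i) && _]andbC.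
rewrite sumr_const card2.
(* Inclusion-exclusion: every support element is below [M] or above [m], and those satisfying both
   lie in block [i], because other blocks are wholly on one side of it. *)
have cnt : (lcount y M + rcount y m = #|supp y| + (#|y i| - 2))%N.
  rewrite /lcount /rcount -cardsUI -card2; congr (_ + _)%N.
    apply: eq_card => b; rewrite !inE; case: (b \in supp y) => //=.
    by case: (ltnP b M) => //= Mb; apply: leq_trans ltmM Mb.
  apply: eq_card => b; rewrite !inE; apply/andP/and3P.
    move=> [/andP[/suppP[j bj] bM] /andP[_ mb]].
    split; [by apply: contraTneq mb => ->; rewrite ltnn
           |by apply: contraTneq bM => ->; rewrite ltnn|].
    suff -> : i = j by [].
    apply: val_inj; case: (ltngtP (i : nat) j) => // ij.
      by have := block_lt ij My bj; lia.
    by have := block_lt ij bj my; lia.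
  move=> [bm bM bi]; have -> : b \in supp y by apply/suppP; exists i.
  split=> /=; rewrite ltn_neqAle ?bM ?[m == b :> nat]eq_sym ?bm.
    exact: maxM.
  exact: minm.
have lec : (#|y i| <= #|supp y|)%N by rewrite card_supp (bigD1 i) //= leq_addr.
rewrite addrA -mulrDl -natrD cnt.
rewrite (natrD _ #|supp y|) natrB //.
have : #|supp y|.-1%:R != 0 :> R by rewrite pnatr_eq0; lia.
have -> : (#|supp y|%:R : R) = #|supp y|.-1%:R + 1.
  by rewrite natr1; congr (_ %:R); lia.
by move=> m0; field.
Qed.

(** Summing block size minus 1 over the [l.+1] blocks gives the first factor; the second is common
    to all blocks. *)
Lemma sum_covers_below y :
  \sum_(x | covers x y) Rflow R x y
    = (#|supp y|%:R - l.+1%:R) * (#|supp y|%:R / #|supp y|.-1%:R).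
Proof.
rewrite big_mkcond; under eq_bigr do rewrite covers_Rflow.
rewrite (exchange_big_dep
  (fun p => (p.1 \in y p.2) && (1 < #|y p.2|)%N)) /=; last first.
  by move=> x p _ st; rewrite (step_mem st) (step_card_block st).
under eq_bigr => p /andP[ay cy].
  have [x st] := step_down ay cy.
  rewrite (big_pred1 x) => [|z /=].
    rewrite (step_down_weight st); over.
  by apply/idP/eqP => [st'|->//]; apply: step_injl st' st.
rewrite -(pair_big_dep xpredT (fun a i => (a \in y i) && (1 < #|y i|)%N)
  (down_weight y)) /= (exchange_big_dep xpredT) //=.
under eq_bigr do rewrite sum_down_weight.
rewrite -mulr_suml sumrB -natr_sum -card_supp sumr_const.
by rewrite card_ord.
Qed.

(** * The grading and the conclusion *)

Lemma Rrank_graded : graded (@Rrank n l) (n - l).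
Proof.
split=> [x|x minx|x maxx|x y /coversP[a [i st]]].
- have := card_supp_ge x; have := subset_leq_card (subsetT (supp x)).
  rewrite cardsT card_ord.
  by rewrite /Rrank; lia.
(* A minimal tuple has only singleton blocks, since a larger block would allow a removal. *)
- have c1 i : #|x i| = 1%N.
    apply/eqP; rewrite eqn_leq card_gt0 block_neq0 andbT leqNgt.
    apply/negP => c2; have /set0Pn[a ai] := block_neq0 x i.
    have [z /step_lt] := step_down ai c2; exact/negP.
  rewrite /Rrank card_supp; under eq_bigr do rewrite c1.
  by rewrite sum1_card card_ord subSnn.
- rewrite /Rrank; suff -> : supp x = setT by rewrite cardsT card_ord.
  apply/setP => a; rewrite inE; apply/negPn/negP => ax.
  case: (pickP (fun i => separated (add_to x a i))) => [i si|no].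
    have [y /step_lt] := sep_step ax si; exact/negP.
  (* Weights summing to 1 force a legal block to exist for any missing [a]. *)
  by have := sum_weight ax; rewrite big_pred0 // => /esym/eqP; rewrite oner_eq0.
by rewrite /Rrank (step_card st); have := card_supp_ge x; lia.
Qed.

End Weight.
End Blocks.

Theorem theorem4p7 (R : realFieldType) (n l : nat) (hln : (l < n)%N) :
  normalized_flow (@Rrank n l) (n - l)%N (@Rflow n l R).
Proof.
split; first exact: (@Rrank_graded _ _ R).
  by move=> x y /coversP[a [i st]]; rewrite (Rflow_step st) weight_ge0.
move=> r /andP[r1 rd]; split.
  (* Rank [r] means a support of size [r + l]. *)
  exists (n - (r + l))%:R; first by rewrite ltr0n; lia.
  move=> x; rewrite /Rrank sum_covers_above; have := card_supp_ge x => lx rx.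
  by congr (_ %:R); lia.
(* Rank [r.+1] means a support of size [(r + l).+1], which exceeds the number [l.+1] of blocks by
   [r]. *)
exists (r%:R * ((r + l).+1%:R / (r + l)%:R)).
  by rewrite mulr_gt0 ?divr_gt0 ?ltr0n //; lia.
move=> y; rewrite /Rrank sum_covers_below; have := card_supp_ge y => ly ry.
have -> : #|supp y| = (r + l).+1 by lia.
by rewrite -natrB ?ltnS ?leq_addl // subSS addnK.
Qed.
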